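(* Let $\mathcal M$ be a map on a surface with set of edges $E$ and set of coedges $E^*$. The set of bases of $\mathcal M$ (equivalently, the set of bases of its Lagrangian matroid $\Delta(\mathcal M)$) is in one-to-one correspondence with the partial duals of $\mathcal M$ that have exactly one face, the correspondence being given by $B\mapsto\partial_{E\setminus B}\mathcal M$. Here partial duals are not considered up to isomorphism: for subsets $A_1\neq A_2$ of $E$, the partial duals $\partial_{A_1}\mathcal M$ and $\partial_{A_2}\mathcal M$ are regarded as distinct even if they are isomorphic as maps. (That is, $B\mapsto E\setminus B$ is a bijection from the set of bases of $\mathcal M$ onto the set of those $A\subseteq E$ for which $\partial_A\mathcal M$ has exactly one face.)
   Context: A map $\mathcal M$ on a surface $S$ is a cellular embedding of a connected graph (loops and multiple edges allowed) into a connected, closed, orientable surface $S$; the connected components of the complement of the graph are the faces, each homeomorphic to an open disc. Let $E=\{e_1,\dots,e_n\}$ be its edges. The dual map $\mathcal M^*$ on $S$ has one vertex (covertex) in each face of $\mathcal M$, and for each edge $e_j$ of $\mathcal M$ an edge (coedge) $e_j^*$ joining the face-centres of the face(s) on the two sides of $e_j$, crossing $e_j$ exactly once and meeting no other edge of $\mathcal M$. Let $E^*=\{e_1^*,\dots,e_n^*\}$. An $n$-subset $B\subset E\cup E^*$ is admissible if for each $j$ exactly one of $e_j,e_j^*$ lies in $B$. A base of $\mathcal M$ is an admissible $n$-subset $B$ such that $S\setminus B$ (the complement of the union of the edges and coedges in $B$) is connected. The bases of $\mathcal M$ are the bases of a Lagrangian matroid denoted $\Delta(\mathcal M)$. For a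 base $B$, $E\setminus B$ is the set of edges of $\mathcal M$ not in $B$. Cartographic description: divide each edge into two half-edges and label the $2n$ half-edges by $\{1,\dots,2n\}$. Then $\mathcal M$ is encoded by $\langle\sigma,\alpha,\varphi\rangle$ with $\sigma,\alpha,\varphi\in S_{2n}$: cycles of $\sigma$ are the counter-clockwise orderings of half-edges around vertices, cycles of $\alpha$ are the pairs of half-edges forming an edge, cycles of $\varphi$ are the counter-clockwise orderings of labels within faces; $\alpha$ is a fixed-point free involution, $\sigma\alpha\varphi=1$ (permutations act on the right), and the group generated is transitive. Conversely such a triple determines a map up to isomorphism, and vertices, edges, faces correspond to cycles of $\sigma,\alpha,\varphi$. Partial dual: write $\alpha=c_1\cdots c_n$ as a product of disjoint transpositions, $c_j$ corresponding to the edge $e_j$. For $A=\{e_{i_1},\dots,e_{i_k}\}\subseteq E$, the partial dual of $\mathcal M$ with respect to $A$ is the map $\partial_A\mathcal M=\langle\sigma c_{i_1}\cdots c_{i_k},\ \alpha,\ c_{i_1}\cdots c_{i_k}\varphi\rangle$. *)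

(* Defs.v *)
From HB Require Import structures.
From Stdlib Require Import Relation_Definitions Relation_Operators.
From mathcomp Require Import all_boot all_order all_fingroup all_algebra.
From mathcomp Require Import all_classical all_reals all_analysis.
Set Implicit Arguments.
Unset Strict Implicit.
Unset Printing Implicit Defensive.
Import Order.TTheory GRing.Theory Num.Theory numFieldNormedType.Exports.
Local Open Scope ring_scope.

(* Half-edges are the elements of 'I_(n.*2).  The product [s * t] of
   permutations applies s first, i.e. permutations act on the right.
   Transitivity on [set: 'I_(n.*2)] entails 0 < n. *)
Record cmap (n : nat) := CMap {
  sigma : 'S_(n.*2);
  alpha : 'S_(n.*2);
  phi : 'S_(n.*2);
  alphaK : involutive alpha;
  alpha_fpf : forall x, alpha x != x;
  cmap_prod : (sigma * alpha * phi = 1)%g;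
  cmap_trans :
    [transitive <<[set sigma; alpha; phi]>>%g, on [set: 'I_(n.*2)] | 'P] }.

Definition nfaces n (M : cmap n) : nat := #|porbits (phi M)|.

Definition edge n (M : cmap n) : finType :=
  {e : {set 'I_(n.*2)} | e \in porbits (alpha M)}.

(* The transposition of alpha attached to e. *)
Definition edge_transp n (M : cmap n) (e : edge M) : 'S_(n.*2) :=
  restr_perm (val e) (alpha M).

Section PartialDual.
Variables (n : nat) (M : cmap n) (A : {set edge M}).
Implicit Types e f : edge M.

Definition transp_prod : 'S_(n.*2) := (\prod_(e in A) edge_transp e)%g.

Let alpha2 : (alpha M * alpha M = 1)%g.
Proof. by apply/permP => x; rewrite permM perm1 alphaK. Qed.

Let transp2 e : (edge_transp e * edge_transp e = 1)%g.
Proof.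
rewrite /edge_transp.
have [aN|aN] := boolP (alpha M \in ('N(val e | 'P))%g).
  by rewrite -morphM // alpha2 morph1.
by rewrite triv_restr_perm ?mulg1.
Qed.

Let transp_comm e f : commute (edge_transp e) (edge_transp f).
Proof.
have [->//|ef] := eqVneq e f.
apply: (perm_onC (restr_perm_on _ _) (restr_perm_on _ _)).
have /imsetP[x _ ex] := valP e; have /imsetP[y _ fy] := valP f.
rewrite -setI_eq0; apply/eqP/setP => z; rewrite !inE.
apply/negP => /andP[]; rewrite ex fy -!eq_porbit_mem => /eqP xz /eqP yz.
by move/eqP: ef; apply; apply: val_inj; rewrite /= ex fy -xz -yz.
Qed.

Lemma transp_prod_comm : commute transp_prod (alpha M).
Proof.
apply/cent1P; apply: group_prod => e _; apply/cent1P.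
exact: restr_perm_commute.
Qed.

Lemma transp_prod2 : (transp_prod * transp_prod = 1)%g.
Proof.
rewrite /transp_prod.
suff : ((\prod_(e in A) edge_transp e) * (\prod_(e in A) edge_transp e) = 1)%g
    /\ forall f, commute (\prod_(e in A) edge_transp e)%g (edge_transp f).
  by case.
elim/big_rec: _ => [|e x _ [x2 xC]].
  by split => [|f]; [rewrite mulg1|exact/commute_sym/commute1].
split=> [|f].
  by rewrite -mulgA (mulgA x) (xC e) -(mulgA _ x) x2 mulg1 transp2.
by apply/commute_sym/commuteM; exact/commute_sym.
Qed.

Lemma partial_dual_prod :
  (sigma M * transp_prod * alpha M * (transp_prod * phi M) = 1)%g.
Proof.
rewrite -(mulgA (sigma M)) transp_prod_comm !mulgA -(mulgA _ _ transp_prod).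
by rewrite transp_prod2 mulg1 cmap_prod.
Qed.

Lemma partial_dual_trans :
  [transitive <<[set (sigma M * transp_prod)%g; alpha M;
                     (transp_prod * phi M)%g]>>%g,
     on [set: 'I_(n.*2)] | 'P].
Proof.
set G := (<<_>>)%g; have /imsetP[x _ _] := cmap_trans M.
set O := orbit 'P G x.
have GN : G \subset ('N(O | 'P))%g by apply: acts_orbit; rewrite finset.subsetT.
have aN : alpha M \in ('N(O | 'P))%g.
  by apply: (fintype.subsetP GN); rewrite mem_gen // !inE eqxx orbT.
have cN : transp_prod \in ('N(O | 'P))%g.
  apply: group_prod => e _; rewrite !inE; apply/fintype.subsetP => y yO; rewrite inE.
  rewrite /= apermE /edge_transp.
  have [eN|eN] := boolP (alpha M \in ('N(val e | 'P))%g); last first.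
    by rewrite triv_restr_perm // perm1.
  have [ye|ye] := boolP (y \in val e); last first.
    by rewrite (out_perm (restr_perm_on _ _)).
  by rewrite restr_permE // -apermE; move: aN => /astabs_act ->.
have sN : (sigma M * transp_prod)%g \in ('N(O | 'P))%g.
  by apply: (fintype.subsetP GN); rewrite mem_gen // !inE eqxx.
have pN : (transp_prod * phi M)%g \in ('N(O | 'P))%g.
  by apply: (fintype.subsetP GN); rewrite mem_gen // !inE eqxx !orbT.
suff -> : [set: 'I_(n.*2)]%SET = O.
  by apply: (imset_f (orbit 'P G)); rewrite orbit_refl.
apply/esym/eqP; rewrite finset.eqEsubset finset.subsetT /=.
rewrite -(atransP (cmap_trans M) x (finset.in_setT x)).
rewrite acts_sub_orbit ?orbit_refl //.
rewrite gen_subG; apply/fintype.subsetP => s.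
rewrite -finset.setUA => /setUP[/set1P ->|/set2P[]->].
- by have := groupMr (sigma M) cN; rewrite sN => <-.
- exact: aN.
- by have := groupMl (phi M) cN; rewrite pN => <-.
Qed.

Definition partial_dual : cmap n :=
  CMap (@alphaK _ M) (@alpha_fpf _ M) partial_dual_prod partial_dual_trans.

End PartialDual.

Local Open Scope classical_set_scope.

(* The edges and coedges together cut the surface into quadrilaterals, one for
   each half-edge d, namely the corner swept counter-clockwise from d to
   [sigma d] at their common vertex.  Quadrilateral d is parametrized by the
   unit square with
     (0, 0) the vertex,            (1, 0) the crossing point on the edge of d,
     (1, 1) the covertex,          (0, 1) the crossing point on that of sigma d,
   so that its sides are, counter-clockwise from the origin: the half-edge d,
   half of the coedge of d, half of the coedge of [sigma d], the half-edge
   [sigma d].  Going counter-clockwise around a covertex, quadrilateral d is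
   followed by quadrilateral [phi d]. *)
Section Surface.
Variables (R : realType) (n : nat) (M : cmap n).

Definition square : set (R * R) := `[0, 1]%classic `*` `[0, 1]%classic.

Inductive glue : relation ('I_(n.*2) * (R * R)) :=
| glue_half_edge d t : 0 <= t <= 1 ->
    glue (d, (0, t)) (sigma M d, (t, 0))
| glue_half_coedge d t : 0 <= t <= 1 ->
    glue (d, (t, 1)) (alpha M (sigma M d), (1, t)).

Definition glued : relation ('I_(n.*2) * (R * R)) := clos_refl_sym_trans _ glue.

(* [surface_map S] presents S as the surface carrying M and its dual: the
   space obtained from the quadrilaterals by the gluing of their sides. *)
Record surface_map (S : topologicalType) := SurfaceMap {
  chart : 'I_(n.*2) -> R * R -> S;
  chart_surj : forall x, exists d, exists2 p, square p & chart d p = x;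
  chart_glued : forall d p d' p', square p -> square p' ->
    (chart d p = chart d' p' <-> glued (d, p) (d', p'));
  chart_open : forall U : set S, open U <->
    forall d, exists2 V, open V & square `&` chart d @^-1` U = square `&` V }.

Variables (S : topologicalType) (q : surface_map S).

Definition half_edge d : set S :=
  [set chart q d (t, 0) | t in `[0, 1]%classic].

Definition half_coedge d : set S :=
  [set chart q d (1, t) | t in `[0, 1]%classic].

(* [inl e] stands for the edge e, [inr e] for the coedge dual to e. *)
Definition curve (c : edge M + edge M) : set S :=
  match c with
  | inl e => \bigcup_(d in [set` val e]) half_edge d
  | inr e => \bigcup_(d in [set` val e]) half_coedge d
  end.

Definition admissible (B : {set edge M + edge M}) : Prop :=
  #|B| = n /\ forall e : edge M, (inl e \in B) (+) (inr e \in B).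

Definition is_base (B : {set edge M + edge M}) : Prop :=
  admissible B /\ connected (~` \bigcup_(c in [set` B]) curve c).

End Surface.

(* Every triple is carried by some surface: the quotient by [glued]. *)
Section GluedSpace.
Variables (R : realType) (n : nat) (M : cmap n).

Definition glued_space : Type :=
  {c : set ('I_(n.*2) * (R * R)) |
     `[< exists d, exists2 p : R * R, square p & c = glued M (d, p) >]}.

HB.instance Definition _ := gen_eqMixin glued_space.
HB.instance Definition _ := gen_choiceMixin glued_space.

Let pt d p (sp : square p) : glued_space :=
  exist _ (glued M (d, p) : set _)
    (asboolT (ex_intro _ d (ex_intro2 _ _ p sp erefl))).

Let square0 : square ((0, 0) : R * R).
Proof. by split; rewrite /= in_itv /= lexx ler01. Qed.

Let ch d (p : R * R) : glued_space :=
  if pselect (square p) is left sp then pt d sp else pt d square0.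

Let chE d p : square p -> val (ch d p) = glued M (d, p) :> set _.
Proof. by rewrite /ch; case: pselect. Qed.

Let ropen (U : set glued_space) := forall d, exists2 V : set (R * R),
  open V & @square R `&` ch d @^-1` U = @square R `&` V.

Let ropenT : ropen setT.
Proof. by move=> d; exists setT => //; exact: openT. Qed.

Let ropenI : setI_closed ropen.
Proof.
move=> U U' oU oU' d; have [V oV e] := oU d; have [V' oV' e'] := oU' d.
exists (V `&` V'); first exact: openI.
have sI (X Y : set (R * R)) : @square R `&` (X `&` Y) = (@square R `&` X) `&` (@square R `&` Y).
  by rewrite setIACA setIid.
by rewrite preimage_setI !sI e e'.
Qed.

Let ropenU (I : Type) (f : I -> set glued_space) : (forall i, ropen (f i)) ->
  ropen (\bigcup_i f i).
Proof.
move=> fo d.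
have /choice[V HV] : forall i, exists V : set (R * R),
  open V /\ @square R `&` ch d @^-1` f i = @square R `&` V.
  by move=> i; have [V ? ?] := fo i d; exists V.
exists (\bigcup_i V i); first by apply: bigcup_open => i _; case: (HV i).
rewrite preimage_bigcup !setI_bigcupr; apply: eq_bigcupr => i _.
by case: (HV i).
Qed.

HB.instance Definition _ := isOpenTopological.Build glued_space
  ropenT ropenI ropenU.

Lemma glued_space_map : surface_map R M glued_space.
Proof.
exists ch.
- move=> x; have /asboolP[d [p sp e]] := valP x.
  by exists d, p => //; apply: val_inj; rewrite chE.
- move=> d p d' p' sp sp'; split => [e|e].
    have : glued M (d, p) = glued M (d', p') :> set _ by rewrite -!chE // e.
    by move=> ->; apply: rst_sym; apply: rst_refl.
  apply: val_inj; rewrite !chE //; apply/seteqP; split => x /= H.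
    by apply: rst_trans H; apply: rst_sym.
  by apply: rst_trans H.
- by [].
Qed.
End GluedSpace.

(* E \ B *)
Definition nonbase_edges n (M : cmap n) (B : {set edge M + edge M}) :
  {set edge M} := [set e | inl e \notin B]%SET.

(* Main.v *)
(* The edges and coedges cut the surface into quadrilaterals, one for each
   half-edge.  Leaving out of B the coedge or the edge of d opens, for each of
   its half-edges d, a passage from quadrilateral d to quadrilateral [phi d] or
   to quadrilateral [sigma^-1 d] = [phi (alpha d)] respectively.  In both cases
   this is the image of d under the face permutation of the partial dual with
   respect to E \ B.  In S \ B each quadrilateral leaves a piece that is
   star-shaped around its centre, hence connected; a vertex or covertex survives
   only if all passages around it are open.  So the components of S \ B
   correspond to the cycles of that permutation. *)
Require Import Defs.
From mathcomp Require Import all_boot all_order all_fingroup all_algebra.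
From mathcomp Require Import all_classical all_reals all_analysis.
From mathcomp Require Import lra.
Set Implicit Arguments.
Unset Strict Implicit.
Unset Printing Implicit Defensive.
Import Order.TTheory GRing.Theory Num.Theory numFieldNormedType.Exports.
Local Open Scope ring_scope.

(** * Edges as orbits of [alpha], and the action of products of their transpositions *)

Section Combinatorics.
Variables (n : nat) (M : cmap n).
Implicit Types (d : 'I_(n.*2)) (e : edge M) (A : {set edge M}).

Lemma edge_of_subproof d : porbit (alpha M) d \in porbits (alpha M).
Proof. exact: imset_f. Qed.

Definition edge_of d : edge M :=
  exist _ (porbit (alpha M) d) (edge_of_subproof d).

Lemma mem_edge e d : (d \in val e) = (e == edge_of d).
Proof.
have /imsetP[x _ ex] := valP e.
rewrite -val_eqE /= ex -eq_porbit_mem eq_sym //.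
Qed.

Lemma edge_of_alpha d : edge_of (alpha M d) = edge_of d.
Proof.
by apply: val_inj; rewrite /= -(porbit_perm _ 1 d) expg1.
Qed.

Lemma edge_transpE e d :
  edge_transp e d = if d \in val e then alpha M d else d.
Proof.
case: ifP => de; last by rewrite (out_perm (restr_perm_on _ _)) ?de.
(* [restr_perm] defaults to the identity unless [alpha M] stabilises the set, so stability of [e]
   has to be checked. *)
rewrite restr_permE //; apply/astabsP => x.
by rewrite /= apermE !mem_edge edge_of_alpha.
Qed.

(** Each edge of [A] is met exactly once along a duplicate-free list. Once its transposition has
    moved [d] to [alpha M d], which lies on the same edge, the remaining factors fix that point. *)
Lemma transp_prodE A d :
  transp_prod A d = if edge_of d \in A then alpha M d else d.
Proof.
have -> : (edge_of d \in A) =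
    (edge_of d \in [seq e <- index_enum (edge M) | e \in A]).
  by rewrite mem_filter mem_index_enum andbT.
rewrite /transp_prod -big_filter.
elim: [seq _ <- _ | _] (filter_uniq (mem A) (index_enum_uniq (edge M))) d
  => [|e r IH] /=.
  by move=> _ d; rewrite big_nil perm1.
move=> /andP[er ur] d; rewrite big_cons permM edge_transpE inE mem_edge eq_sym.
case: eqVneq => [de|_] /=; last exact: IH.
by rewrite IH // edge_of_alpha de (negPf er).
Qed.

Lemma phiE d : phi M (alpha M (sigma M d)) = d.
Proof. by rewrite -!permM mulgA cmap_prod perm1. Qed.

Lemma porbit_alpha d : porbit (alpha M) d = [set d; alpha M d]%SET.
Proof.
apply/setP => x; rewrite !inE; apply/porbitP/orP => [[i ->]|].
  elim: i => [|i IH]; first by left; rewrite expg0 perm1.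
  rewrite expgSr permM; case: IH => /eqP ->; first by right.
  by left; rewrite alphaK.
by case=> /eqP ->; [exists 0%N; rewrite expg0 perm1|exists 1%N; rewrite expg1].
Qed.

(** A fixed-point free involution splits the [n.*2] half-edges into orbits of size two. *)
Lemma card_edge : #|{: edge M}| = n.
Proof.
apply: double_inj.
rewrite card_sig -[in RHS](card_ord n.*2) -cardsT.
have part : finset.partition (porbits (alpha M)) [set: 'I_(n.*2)]%SET.
  have -> : porbits (alpha M) = orbit 'P <[alpha M]>%g @: [set: 'I_(n.*2)]%SET.
    by apply/setP => c; apply/imsetP/imsetP => -[x _ ->]; exists x;
      rewrite ?inE // porbit.unlock.
  by apply: (@orbit_partition _ _ _ 'P%act); apply/actsP => a _ x; rewrite !inE.
rewrite (@card_uniform_partition _ 2 _ _ _ part) ?muln2 //.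
move=> _ /imsetP[x _ ->]; rewrite porbit_alpha cards2 eq_sym.
by rewrite alpha_fpf.
Qed.

End Combinatorics.

Local Open Scope classical_set_scope.

(** * The union of the chosen curves, seen in the quadrilaterals *)

Section Topology.
Variables (R : realType) (n : nat) (M : cmap n) (S : topologicalType).
Variables (q : surface_map R M S) (A : {set edge M}).
Implicit Types (d : 'I_(n.*2)) (p : R * R).

(** This is the face permutation of [partial_dual A]; its cycles are the faces to be counted. *)
Definition face_perm : 'S_(n.*2) := (transp_prod A * phi M)%g.

Lemma face_permE d :
  face_perm d = if edge_of M d \in A then phi M (alpha M d) else phi M d.
Proof. by rewrite permM transp_prodE; case: ifP. Qed.

Lemma phi_alphaK d : phi M (alpha M d) = (sigma M)^-1%g d.
Proof. by rewrite -{1}(permKV (sigma M) d) phiE. Qed.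

(* The union of the curves of the base whose set of missing edges is [A]. *)
Definition cut_curves : set S :=
  [set x | exists d,
     if edge_of M d \in A then half_coedge q d x else half_edge q d x].

(** The cases are the bottom, left, right and top sides of quadrilateral [d]: on the edges of [d]
    and [sigma M d], then on their coedges. *)
Definition cut_side d p : Prop :=
  [\/ p.2 = 0 /\ edge_of M d \notin A,
      p.1 = 0 /\ edge_of M (sigma M d) \notin A,
      p.1 = 1 /\ edge_of M d \in A | p.2 = 1 /\ edge_of M (sigma M d) \in A].

Definition corner : set (R * R) := [set 0; 1] `*` [set 0; 1].

(* Corners are included because whether a vertex is cut depends on all the
   edges around it, not on a single quadrilateral. *)
Lemma glue_cut x y : Defs.glue M x y ->
  (corner x.2 \/ cut_side x.1 x.2) <-> (corner y.2 \/ cut_side y.1 y.2).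
Proof.
case=> {x y} d t _ /=; rewrite /corner /cut_side /=.
  have [->|t0] := pselect (t = 0).
    by split=> _; left; split; left.
  have [->|t1] := pselect (t = 1).
    by split=> _; left; split; (by left) || (by right).
  have o01 : 0 <> 1 :> R by apply/eqP; rewrite eq_sym oner_eq0.
  split; case=> [[[?|?] [?|?]]|[[? ?]|[? ?]|[? ?]|[? ?]]] //=; right;
    by [constructor 1|constructor 2].
rewrite edge_of_alpha.
have [->|t0] := pselect (t = 0).
  by split=> _; left; split; (by left) || (by right).
have [->|t1] := pselect (t = 1).
  by split=> _; left; split; right.
have o01 : 1 <> 0 :> R by apply/eqP; rewrite oner_eq0.
split; case=> [[[?|?] [?|?]]|[[? ?]|[? ?]|[? ?]|[? ?]]] //=; right;
    by [constructor 3|constructor 4].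
Qed.

Lemma glued_ind_iff (P : 'I_(n.*2) * (R * R) -> Prop) x y :
  (forall x y, Defs.glue M x y -> P x <-> P y) -> glued M x y -> P x <-> P y.
Proof.
move=> gP; elim=> {x y} [x y /gP//|x|x y _ [? ?]|x y z _ [? ?] _ [? ?]] //.
by split; auto.
Qed.

Lemma squareE p : @square R p <-> 0 <= p.1 <= 1 /\ 0 <= p.2 <= 1.
Proof. by split=> [[]|[? ?]]; [|split]; rewrite /= ?in_itv. Qed.

Lemma square_side (t : R) : 0 <= t <= 1 ->
  [/\ @square R (t, 0), @square R (0, t), @square R (t, 1) & @square R (1, t)].
Proof.
by move=> t01; split; apply/squareE; split; rewrite //= ?lexx ?ler01.
Qed.

(** A cut point is glued to a point on the bottom or right side of some square, where the conclusion
    is clear; [glue_cut] carries it back along the gluing. *)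
Lemma cut_curves_chart d p : @square R p ->
  cut_curves (chart q d p) -> corner p \/ cut_side d p.
Proof.
move=> sp [d']; case: ifP => dA [t /= t01 /esym] /(chart_glued q d d' sp) e;
  rewrite /= in_itv /= in t01; have [t0 t0' t1 t1'] := square_side t01.
  have := glued_ind_iff glue_cut (e t1') => /= -> //; right;
    constructor 3; split=> //=.
have := glued_ind_iff glue_cut (e t0) => /= -> //.
by right; constructor 1; split; rewrite //= dA.
Qed.

Lemma chart_glue x y : Defs.glue M x y -> chart q x.1 x.2 = chart q y.1 y.2.
Proof.
move=> xy; apply/chart_glued; last first.
  by apply: Relation_Operators.rst_step; case: xy => d t t01; constructor.
  by case: xy => d t /square_side[].
by case: xy => d t /square_side[].
Qed.

Lemma chart_half_edge d t : 0 <= t <= 1 ->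
  chart q d (0, t) = chart q (sigma M d) (t, 0).
Proof. by move=> t01; exact: (chart_glue (glue_half_edge M d t01)). Qed.

Lemma chart_half_coedge d t : 0 <= t <= 1 ->
  chart q d (t, 1) = chart q (alpha M (sigma M d)) (1, t).
Proof. by move=> t01; exact: (chart_glue (glue_half_coedge M d t01)). Qed.

Lemma cut_side_chart d p : @square R p -> cut_side d p ->
  cut_curves (chart q d p).
Proof.
case: p => x y /squareE[/= x01 y01] [][/= -> dA].
- by exists d; rewrite (negPf dA); exists x => //=; rewrite in_itv.
- exists (sigma M d); rewrite (negPf dA) chart_half_edge //.
  by exists y => //=; rewrite in_itv.
- by exists d; rewrite dA; exists y => //=; rewrite in_itv.
- exists (alpha M (sigma M d)); rewrite edge_of_alpha dA chart_half_coedge //.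
  by exists x => //=; rewrite in_itv.
Qed.

Lemma closed_cut_side d : closed (cut_side d).
Proof.
have cl (f : R * R -> R) c (b : bool) :
    continuous f -> closed [set p | f p = c /\ b].
  move=> fc; case: b; last first.
    rewrite (_ : mkset _ = set0); first exact: closed0.
    by apply/seteqP; split=> p [].
  rewrite (_ : mkset _ = f @^-1` [set c]).
    by apply: closed_comp => // *; exact: closed_eq.
  by apply/seteqP; split=> p //= [].
have -> : cut_side d = [set p | p.2 = 0 /\ edge_of M d \notin A] `|`
    [set p | p.1 = 0 /\ edge_of M (sigma M d) \notin A] `|`
    [set p | p.1 = 1 /\ edge_of M d \in A] `|`
    [set p | p.2 = 1 /\ edge_of M (sigma M d) \in A].
  apply/seteqP; split => p.
    by case; [left; left; left|left; left; right|left; right|right].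
  by case=> [[[]|]|]; [constructor 1|constructor 2|constructor 3|constructor 4].
by repeat apply: closedU; apply: cl => x; (exact: cvg_fst || exact: cvg_snd).
Qed.

Lemma finite_corner : finite_set corner.
Proof. by apply: finite_setX; exact: finite_set2. Qed.

(** Within one square the cut points are the closed cut sides together with some of the four
    corners, hence form a closed set. *)
Lemma open_chart_uncut d : exists2 V : set (R * R), open V &
  @square R `&` chart q d @^-1` (~` cut_curves) = @square R `&` V.
Proof.
exists (~` (cut_side d `|` (corner `&` chart q d @^-1` cut_curves))).
  apply: closed_openC; apply: closedU; first exact: closed_cut_side.
  apply: (accessible_finite_set_closed.1 (hausdorff_accessible _)).
    exact: norm_hausdorff.
  exact: finite_setIl finite_corner.
apply/seteqP; split=> p [sp].
  by move=> pc; split=> // -[/(cut_side_chart sp)|[]].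
move=> pV; split=> //= pc; apply: pV.
by have [] := cut_curves_chart sp pc; [right|left].
Qed.

Lemma chart_continuous d : {within @square R, continuous (chart q d)}.
Proof.
apply/continuousP => U oU; apply/open_subspaceP.
have [V oV e] := (chart_open q U).1 oU d.
by exists V; rewrite // setIC -e setIC.
Qed.

(** * Connected pieces of the quadrilaterals and the passages between them *)

Definition region d : set S :=
  chart q d @` (@square R `&` chart q d @^-1` (~` cut_curves)).

Lemma interior_uncut d (x y : R) : 0 < x < 1 -> 0 < y < 1 ->
  @square R (x, y) /\ ~ cut_curves (chart q d (x, y)).
Proof.
move=> /andP[x0 x1] /andP[y0 y1]; have sp : @square R (x, y).
  by apply/squareE; rewrite /= !ltW.
split=> // /(cut_curves_chart sp).
by case=> [[/= []]|[]/= []] e; move: x0 x1 y0 y1; rewrite e ltxx.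
Qed.

Lemma region_connected d : connected (region d).
Proof.
apply: connected_continuous_connected; last first.
  apply: continuous_subspaceW (@chart_continuous d); exact: subIsetl.
set Q := _ `&` _.
(* [seg p] runs from the centre of the square at [t = 0] to [p] at [t = 1]; for [t < 1] it stays in
   the open square, which meets no cut curve. *)
pose seg p (t : R) := (2^-1 + t * (p.1 - 2^-1), 2^-1 + t * (p.2 - 2^-1)).
have -> : Q = \bigcup_(p in Q) (seg p @` `[0, 1]).
  apply/seteqP; split=> [p Qp|p [p' Qp' [t /=]]].
    exists p => //; exists 1; first by rewrite /= in_itv /= lexx ler01.
    by case: p {Qp} => x y; rewrite /seg /= !mul1r !subrKC.
  rewrite in_itv /= => /andP[t0]; rewrite le_eqVlt => /predU1P[->|t1] <-.
    by case: p' Qp' => x y; rewrite /seg /= !mul1r !subrKC.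
  have [/squareE[/= /andP[? ?] /andP[? ?]] _] := Qp'.
  by apply: interior_uncut; apply/andP; split; nra.
apply: bigcup_connected.
  exists (2^-1, 2^-1) => p _; exists 0.
    by rewrite /= in_itv /= lexx ler01.
  by rewrite /seg !mul0r !addr0.
move=> p _; apply: connected_continuous_connected.
  exact: segment_connected.
apply: continuous_subspaceT.
have lin (a b : R) : continuous (fun t : R => a + t * b : R).
  by move=> t; apply: cvgD; [exact: cvg_cst|exact: mulrr_continuous].
move=> t; exact: cvg_pair (lin _ _ t) (lin _ _ t).
Qed.

Lemma bigcup_region : ~` cut_curves = \bigcup_d region d.
Proof.
apply/seteqP; split=> [x Xx|x [d _ [p [sp pX] <-]]] //.
by have [d [p sp px]] := chart_surj q x;
  exists d => //; exists p; rewrite //= px.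
Qed.

Lemma half01 : 0 < (2^-1 : R) < 1.
Proof. by apply/andP; split; lra. Qed.

(* The common point is the midpoint of the uncut side they share. *)
Lemma region_face_perm d : region d `&` region (face_perm d) !=set0.
Proof.
have h01 : 0 <= (2^-1 : R) <= 1 by case/andP: half01 => *; rewrite !ltW.
have [s1 s2 s3 s4] := square_side h01.
have h0 : (2^-1 : R) <> 0 by move=> h; move: half01; rewrite h ltxx.
have h1 : (2^-1 : R) <> 1 by move=> h; move: half01; rewrite h ltxx andbF.
have o01 : 1 <> 0 :> R by apply/eqP; rewrite oner_eq0.
rewrite face_permE; case: ifPn => dA.
  have e : chart q (phi M (alpha M d)) (0, 2^-1) = chart q d (2^-1, 0).
    by rewrite chart_half_edge // phi_alphaK permKV.
  have nc : ~ cut_curves (chart q d (2^-1, 0)).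
    move=> /(cut_curves_chart s1)[[/= []]//|[][]//=]; first by rewrite dA.
    by move=> /esym.
  exists (chart q d (2^-1, 0)); split; first by exists (2^-1, 0).
  by exists (0, 2^-1) => //; split=> //=; rewrite e.
have e : chart q (phi M d) (2^-1, 1) = chart q d (1, 2^-1).
  rewrite chart_half_coedge //; congr (chart q _ _).
  by apply: (@perm_inj _ (phi M)); rewrite phiE.
have nc : ~ cut_curves (chart q d (1, 2^-1)).
  by move=> /(cut_curves_chart s4)[[_ /= []]//|[][]//=]; rewrite ?(negPf dA).
exists (chart q d (1, 2^-1)); split; first by exists (1, 2^-1).
by exists (2^-1, 1) => //; split=> //=; rewrite e.
Qed.

(** The regions along the cycle of [d] form a chain in which neighbours meet, and this chain reaches
    every quadrilateral. *)
Lemma connected_uncut_of_porbit d :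
  (forall d', d' \in porbit face_perm d) -> connected (~` cut_curves).
Proof.
move=> porb.
pose Y k := \bigcup_(i in [set i | (i <= k)%N]) region ((face_perm ^+ i)%g d).
have Yc k : connected (Y k).
  elim: k => [|k IH].
    rewrite (_ : Y 0%N = region d); first exact: region_connected.
    rewrite /Y (_ : mkset _ = [set 0%N]).
      by rewrite bigcup_set1 expg0 perm1.
    by apply/seteqP; split=> i /=; rewrite leqn0 => /eqP.
  have -> : Y k.+1 = Y k `|` region ((face_perm ^+ k.+1)%g d).
    apply/seteqP; split=> [x [i /= + xi]|x [[i /= ik xi]|xk]].
    - rewrite leq_eqVlt ltnS => /predU1P[ik|ik]; first by right; rewrite -ik.
      by left; exists i.
    - by exists i; rewrite //= leqW.
    - by exists k.+1 => /=.
  apply: connectedU => //; last exact: region_connected.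
  have [x [x1 x2]] := region_face_perm ((face_perm ^+ k)%g d).
  by exists x; rewrite expgSr permM; split=> //; exists k => /=.
(* All the [Y k] contain the nonempty [region d], so their union stays connected. *)
rewrite bigcup_region (_ : \bigcup_d region d = \bigcup_k Y k).
  apply: bigcup_connected => //.
  have [x [xd _]] := region_face_perm d.
  by exists x => k _; exists 0%N; rewrite //= expg0 perm1.
apply/seteqP; split=> [x [d' _ xd']|x [k _ [i _ xi]]]; last first.
  by exists ((face_perm ^+ i)%g d).
by have /porbitP[i e] := porb d'; exists i => //; exists i; rewrite /= -?e.
Qed.

(** An uncut point on a glued side, even at a corner, shows that this side is open. Then [face_perm]
    sends [y.1] to [x.1], for an edge and for a coedge alike. *)
Lemma glue_uncut_porbit d0 x y : Defs.glue M x y ->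
  ~ cut_curves (chart q x.1 x.2) ->
  (x.1 \in porbit face_perm d0) = (y.1 \in porbit face_perm d0).
Proof.
have st d : (face_perm d \in porbit face_perm d0) = (d \in porbit face_perm d0).
  by rewrite -!eq_porbit_mem -[in X in X = _](expg1 face_perm) porbit_perm.
move=> xy; case: xy => {x y} d t t01 /= nc;
    have [s1 s2 s3 s4] := square_side t01.
  have dA : edge_of M (sigma M d) \in A.
    apply: contrapT => /negP dA; apply: nc.
    by apply: cut_side_chart => //; constructor 2.
  by rewrite -[in RHS]st face_permE dA phiE.
have dA : edge_of M (sigma M d) \notin A.
  by apply/negP => dA; apply: nc; apply: cut_side_chart => //; constructor 4.
by rewrite -[in RHS]st face_permE edge_of_alpha (negPf dA) phiE.
Qed.
(** The regions indexed by the cycle of [d0] and the other regions have disjoint open unions that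
    cover the uncut part, so connectedness rules out the latter. *)
Lemma porbit_of_connected_uncut d0 : connected (~` cut_curves) ->
  forall d, d \in porbit face_perm d0.
Proof.
move=> Xc.
pose U d p := ~ cut_curves (chart q d p) /\ d \in porbit face_perm d0.
(* Whether an uncut point belongs to the cycle of [d0] does not depend on the square representing
   it. *)
have Uinv d p d' p' : @square R p -> @square R p' ->
    chart q d p = chart q d' p' -> U d p <-> U d' p'.
  move=> sp sp' /(chart_glued q d d' sp sp').
  apply: (glued_ind_iff (P := fun x => U x.1 x.2)) => x y xy.
  have := glue_uncut_porbit d0 xy; rewrite /U (chart_glue xy) => e.
  by split=> -[nc ?]; split=> //; [rewrite -e|rewrite e].
pose C (b : bool) :=
  \bigcup_(d in [set d | (d \in porbit face_perm d0) == b]) region d.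
(* Inside each square, [C b] is either the whole set of uncut points or empty. *)
have Copen b : open (C b).
  apply/(chart_open q) => d.
  have [bd|bd] := boolP ((d \in porbit face_perm d0) == b).
    have [V oV e] := open_chart_uncut d; exists V => //; rewrite -e.
    apply/seteqP; split=> p [sp]; last first.
      by move=> pX; split=> //; exists d => //; exists p.
    by move=> [d' _ [p' [sp' pX'] e']]; split=> //=; rewrite -e'.
  exists set0; first exact: open0.
  rewrite setI0; apply/seteqP; split=> p // [sp [d' /= bd' [p' [sp' pX'] e']]].
  have := Uinv _ _ _ _ sp' sp e'; rewrite /U -e'.
  case: (d \in _) (d' \in _) b bd bd' => [] [] [] //= _ _ H.
    by have [] := H.2 (conj pX' isT).
  by have [] := H.1 (conj pX' isT).
have CX b : C b `<=` ~` cut_curves.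
  by rewrite bigcup_region; apply: bigcup_subset.
have disj x : C true x -> C false x -> False.
  move=> [d /= /eqP db [p [sp pX] <-]] [d' /= /eqP db' [p' [sp' pX'] e']].
  by have [] := (Uinv _ _ _ _ sp' sp e').2 (conj pX db); rewrite db'.
have cover : ~` cut_curves `<=` C true `|` C false.
  rewrite bigcup_region => x [d _ xd].
  case E : (d \in porbit face_perm d0);
    by [left; exists d; rewrite //= E|right; exists d; rewrite //= E].
have CE : C true = ~` cut_curves.
  apply: Xc.
  - have [x [xd _]] := region_face_perm d0.
    by exists x, d0; rewrite //= porbit_id.
  - by exists (C true) => //; by rewrite setIidr //; exact: CX.
  (* Relative to the uncut part, [C true] is the complement of the open set [C false]. *)
  - exists (~` C false); first exact: open_closedC.
    apply/seteqP; split=> x.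
      by move=> xC; split; [exact: CX xC|exact: disj].
    by case=> /cover[].
move=> d; have [x [xd _]] := region_face_perm d.
apply: contrapT => /negP/negPf dn.
have xF : C false x by exists d; rewrite //= dn.
by apply: (disj x) => //; rewrite CE; exact: CX xF.
Qed.

Lemma connected_uncutP :
  connected (~` cut_curves) <-> nfaces (partial_dual A) = 1%N.
Proof.
(* Transitivity supplies a half-edge, hence a cycle with which to compare all others. *)
have /imsetP[d0 _ _] := cmap_trans M.
rewrite /nfaces /= -/face_perm; split=> [Xc|/eqP/cards1P[c porbc]].
  have d0c := porbit_of_connected_uncut d0 Xc.
  apply/eqP/cards1P; exists (porbit face_perm d0); apply/setP => c; rewrite inE.
  apply/imsetP/eqP => [[d _ ->]|->]; last by exists d0.
  by apply/eqP; rewrite eq_porbit_mem.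
apply: (@connected_uncut_of_porbit d0) => d.
have /set1P e : porbit face_perm d \in [set c]%SET by rewrite -porbc imset_f.
have /set1P e0 : porbit face_perm d0 \in [set c]%SET by rewrite -porbc imset_f.
by rewrite -eq_porbit_mem e e0.
Qed.
End Topology.

(** * Admissible sets and subsets of edges *)

Section Bases.
Variables (R : realType) (n : nat) (M : cmap n) (S : topologicalType).
Variables (q : surface_map R M S).
Implicit Types (A : {set edge M}) (B : {set edge M + edge M}).

(** Admissibility puts a coedge in [B] exactly when its edge is missing, so the missing edges
    determine the union of curves. *)
Lemma bigcup_curve B : admissible B ->
  \bigcup_(c in [set` B]) curve q c = cut_curves q (nonbase_edges B).
Proof.
case=> _ adm; apply/seteqP; split=> [x [[e|e] /= eB [d /= de xd]]|x [d]].
- exists d; move: de; rewrite mem_edge => /eqP <-.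
  by rewrite inE eB.
- exists d; move: de; rewrite mem_edge => /eqP <-.
  by have := adm e; rewrite inE eB addbT => ->.
- have de : d \in val (edge_of M d) by rewrite mem_edge.
  have := adm (edge_of M d); rewrite inE;
    case: ifP => [/negPf -> /= eB xd|/negbFE eB _ xd].
    by exists (inr (edge_of M d)) => //; exists d.
  by exists (inl (edge_of M d)) => //; exists d.
Qed.

Lemma is_base_nfaces B : is_base q B <->
  admissible B /\ nfaces (partial_dual (nonbase_edges B)) = 1%N.
Proof.
rewrite /is_base; split=> -[adm]; rewrite bigcup_curve //;
  by move=> /connected_uncutP.
Qed.

(** This is the inverse of [nonbase_edges] on admissible sets. *)
Definition base_of_nonbase A : {set edge M + edge M} :=
  [set c | match c with inl e => e \notin A | inr e => e \in A end]%SET.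

Lemma base_of_nonbaseK : cancel base_of_nonbase (@nonbase_edges n M).
Proof. by move=> A; apply/setP => e; rewrite !inE negbK. Qed.

Lemma admissible_base_of_nonbase A : admissible (base_of_nonbase A).
Proof.
split=> [|e]; last by rewrite !inE addNb addbb.
(* The [n] edges split into [A], counted by coedges, and its complement, counted by edges. *)
rewrite -[RHS](card_edge M) -(cardC A) addnC -!sum1_card big_sumType /=.
by congr addn; apply: eq_bigl => e; rewrite !inE.
Qed.

Lemma admissible_eq B : admissible B -> B = base_of_nonbase (nonbase_edges B).
Proof.
case=> _ adm; apply/setP => -[e|e]; rewrite !inE ?negbK //.
by have := adm e; case: (inl e \in B) (inr e \in B) => [] [].
Qed.

End Bases.

Theorem theorem3p2 (R : realType) (n : nat) (M : cmap n)
    (S : topologicalType) (q : surface_map R M S) :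
  set_bij [set B | is_base q B]
          [set A : {set edge M} | nfaces (partial_dual A) = 1%N]
          (@nonbase_edges n M).
Proof.
split.
- by move=> B /is_base_nfaces[].
(* An admissible set is recovered from its missing edges. *)
- move=> B B' /set_mem/is_base_nfaces[adm _] /set_mem/is_base_nfaces[adm' _] e.
  by rewrite (admissible_eq adm) e -admissible_eq.
- move=> A /= A1; exists (base_of_nonbase A); last exact: base_of_nonbaseK.
  apply/is_base_nfaces; rewrite base_of_nonbaseK; split=> //.
  exact: admissible_base_of_nonbase.
Qed.
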